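(* Consider the query phase of Zoom-SVD (defined in the context) with block size $b$, for a multiple time series with $c$ time series, where $k$ is the number of singular values. Given a time range query $[t_s,t_e]$, the time cost of the query phase is $$O\Big((t_e-t_s)\,k\Big(k+\frac{c^2}{b}\Big)+k^2(b+c)\Big).$$
   Context: **Setting.** A multiple time series is a matrix $\mathbf{A}=[\mathbf{a}_1;\dots;\mathbf{a}_t]\in\mathbb{R}^{t\times c}$, where $[\,;\,]$ is vertical concatenation, $t$ is the time length and $c$ is the number of time series. For a block size $b$, the $i$-th block ($i=0,1,2,\dots$) is $\mathbf{A}^{(i)}=[\mathbf{a}_{bi+1};\dots;\mathbf{a}_{bi+b}]\in\mathbb{R}^{b\times c}$. For each block, a truncated SVD result $\mathbf{A}^{(i)}\simeq\mathbf{U}_{(i)}\mathbf{\Sigma}_{(i)}\mathbf{V}_{(i)}^{T}$ has been computed and stored beforehand in a storage phase, where $\mathbf{U}_{(i)}\in\mathbb{R}^{b\times k_{(i)}}$ and $\mathbf{V}_{(i)}\in\mathbb{R}^{c\times k_{(i)}}$ are column orthogonal and $\mathbf{\Sigma}_{(i)}\in\mathbb{R}^{k_{(i)}\times k_{(i)}}$ is diagonal with descending singular values. **Low-rank approximation.** For a matrix with singular values $\sigma_1\ge\dots\ge\sigma_r$ ($r$ its rank), low-rank approximation using SVD keeps the $k$ largest singular values and the corresponding singular vectors, where $k$ is the smallest element of $\{1,\dots,r\}$ with $\sum_{i=1}^k\sigma_i^2/\sum_{i=1}^r\sigma_i^2\ge\xi$, for a fixed threshold $\xi\in(0,1)$.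 **Query phase.** Given a time range $[t_s,t_e]$, let $S$ and $E$ be the indices of the blocks containing $t_s$ and $t_e$. *Step 1 (Partial-SVD).* Let $r_S$ be the number of rows of $\mathbf{A}^{(S)}$ lying before $t_s$ and $b_S=b-r_S$; let $r_E$ be the number of rows of $\mathbf{A}^{(E)}$ lying after $t_e$ and $b_E=b-r_E$. Let $\mathbf{X}_s=[\,\mathbf{0}_{b_S\times r_S}\ \ \mathbf{I}_{b_S}\,]$ and $\mathbf{X}_e=[\,\mathbf{I}_{b_E}\ \ \mathbf{0}_{b_E\times r_E}\,]$ (multiplying by these selects the rows inside the query range). Compute the low-rank approximation $\tilde{\mathbf U}_{(S)}\tilde{\mathbf\Sigma}_{(S)}\tilde{\mathbf V}_{(S)}^{T}$ of $\mathbf{X}_s\mathbf{U}_{(S)}\mathbf{\Sigma}_{(S)}$ using SVD, and set $\mathbf{U}'_{(S)}=\tilde{\mathbf U}_{(S)}$, $\mathbf{\Sigma}'_{(S)}=\tilde{\mathbf\Sigma}_{(S)}$, $\mathbf{V}'^{T}_{(S)}=\tilde{\mathbf V}_{(S)}^{T}\mathbf{V}_{(S)}^{T}$. Do the same for $E$ with $\mathbf{X}_e\mathbf{U}_{(E)}\mathbf{\Sigma}_{(E)}$, giving $\mathbf{U}'_{(E)},\mathbf{\Sigma}'_{(E)},\mathbf{V}'_{(E)}$. *Step 2 (Stitched-SVD).* Form the vertically stacked matrix $\mathbf{M}=[\mathbf{\Sigma}'_{(S)}\mathbf{V}'^{T}_{(S)};\ \mathbf{\Sigma}_{(S+1)}\mathbf{V}_{(S+1)}^{T};\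 \dots;\ \mathbf{\Sigma}_{(E-1)}\mathbf{V}_{(E-1)}^{T};\ \mathbf{\Sigma}'_{(E)}\mathbf{V}'^{T}_{(E)}]$ and compute its low-rank approximation $\mathbf{U}_r\mathbf{\Sigma}_r\mathbf{V}_r^{T}$ using SVD. Split the rows of $\mathbf{U}_r$ conformally with the stacking into $\mathbf{U}'_{r(S)},\mathbf{U}_{r(S+1)},\dots,\mathbf{U}_{r(E-1)},\mathbf{U}'_{r(E)}$. Output $\mathbf{V}_{(S:E)}=\mathbf{V}_r$, $\mathbf{\Sigma}_{(S:E)}=\mathbf{\Sigma}_r$, and $\mathbf{U}_{(S:E)}=[\mathbf{U}'_{(S)}\mathbf{U}'_{r(S)};\ \mathbf{U}_{(S+1)}\mathbf{U}_{r(S+1)};\ \dots;\ \mathbf{U}_{(E-1)}\mathbf{U}_{r(E-1)};\ \mathbf{U}'_{(E)}\mathbf{U}'_{r(E)}]$, computed block by block. **Conventions.** Here $k$ is the number of singular values retained, a single symbol $k$ being used for all SVD results (those of the stored blocks, of Partial-SVD and of the final output). Cost is the number of arithmetic operations: computing the SVD of an $n\times m$ dense matrix costs $O(\min(n^2m,nm^2))$, and multiplying a $p\times q$ matrix by a $q\times s$ matrix costs $O(pqs)$. *)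

(* Defs.v *)
From mathcomp Require Export all_boot all_order all_algebra.
From mathcomp Require Export reals.

Set Implicit Arguments.
Unset Strict Implicit.
Unset Printing Implicit Defensive.

Import Order.TTheory GRing.Theory Num.Theory.
Local Open Scope ring_scope.

(* A value together with the number of arithmetic operations spent on it. *)
Record costed (T : Type) := Costed { value : T; cost : nat }.

Definition ret (T : Type) (x : T) : costed T := Costed x 0.

Definition bind (T U : Type) (m : costed T) (f : T -> costed U) : costed U :=
  Costed (value (f (value m))) (cost m + cost (f (value m)))%N.

Definition tick (n : nat) : costed unit := Costed tt n.

Definition gather (n : nat) (T : 'I_n -> Type) (F : forall i, costed (T i)) :
    costed (forall i, T i) :=
  Costed (fun i => value (F i)) (\sum_(i < n) cost (F i))%N.

Notation "'let*' x := m 'in' f" := (bind m (fun x => f))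
  (at level 200, x name, m at level 100, f at level 200).

Section ZoomSVD.

Variable R : realType.

(* The factors of U * Sigma * V^T with sr singular values; Sigma is stored as
   its diagonal. *)
Record svd_triple (n m : nat) := SVDTriple {
  sr : nat;
  sU : 'M[R]_(n, sr);
  sS : 'rV[R]_sr;
  sV : 'M[R]_(m, sr)
}.

(* Compact SVD: the singular values are positive, so sr F is the rank of A. *)
Definition is_svd (n m : nat) (A : 'M[R]_(n, m)) (F : svd_triple n m) : Prop :=
  [/\ (sU F)^T *m sU F = 1%:M,
      (sV F)^T *m sV F = 1%:M,
      forall i, 0 < sS F 0 i,
      forall i j : 'I_(sr F), (i <= j)%N -> sS F 0 j <= sS F 0 i
    & A = sU F *m diag_mx (sS F) *m (sV F)^T].

Definition truncate (n m j : nat) (F : svd_triple n m) : svd_triple n m :=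
  let w := widen_ord (geq_minr j (sr F)) in
  SVDTriple (colsub w (sU F)) (colsub w (sS F)) (colsub w (sV F)).

Definition is_truncated_svd (n m : nat) (A : 'M[R]_(n, m))
    (F : svd_triple n m) : Prop :=
  exists (G : svd_triple n m) (j : nat), is_svd A G /\ F = truncate j G.

Definition energy (n m : nat) (F : svd_triple n m) (j : nat) : R :=
  (\sum_(i < sr F | (i < j)%N) sS F 0 i ^+ 2) / (\sum_(i < sr F) sS F 0 i ^+ 2).

(* The smallest j in {1, ..., r} whose energy reaches xi; it is 0 for the zero
   matrix, where r = 0. *)
Definition retained (n m : nat) (xi : R) (F : svd_triple n m) : nat :=
  head 0%N [seq j <- iota 1 (sr F) | xi <= energy F j].

Definition svd_routine : Type :=
  forall n m : nat, 'M[R]_(n, m) -> costed (svd_triple n m).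

Definition mul_routine : Type :=
  forall p q s : nat, 'M[R]_(p, q) -> 'M[R]_(q, s) -> costed 'M[R]_(p, s).

(* [0 I] and [I 0], with b columns and b - r rows. *)
Definition select_last (b r : nat) : 'M[R]_(b - r, b) :=
  \matrix_(i, j) (j == (r + i)%N :> nat)%:R.

Definition select_first (b r : nat) : 'M[R]_(b - r, b) :=
  \matrix_(i, j) (j == i :> nat)%:R.

Lemma select_lastE (b r n : nat) (U : 'M[R]_(b, n)) (i : 'I_(b - r))
    (l : 'I_b) (hl : l = (r + i)%N :> nat) :
  row i (select_last b r *m U) = row l U.
Proof.
apply/rowP => j; rewrite !mxE (bigD1 l) //= mxE hl eqxx mul1r.
rewrite big1 ?addr0 // => x xl; rewrite mxE -hl.
by rewrite (inj_eq val_inj) (negbTE xl) mul0r.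
Qed.

Lemma select_firstE (b r n : nat) (U : 'M[R]_(b, n)) (i : 'I_(b - r)) :
  row i (select_first b r *m U) = row (widen_ord (leq_subr r b) i) U.
Proof.
set l := widen_ord _ _; apply/rowP => j.
rewrite !mxE (bigD1 l) //= mxE eqxx mul1r.
rewrite big1 ?addr0 // => x xl; rewrite mxE.
by rewrite (_ : (_ == _) = (x == l)) // (negbTE xl) mul0r.
Qed.

Section Algorithm.

Variables (svd : svd_routine) (mul : mul_routine) (xi : R).

(* Besides the SVD itself, evaluating the energy ratios is charged one squaring,
   one addition and one division per singular value. *)
Definition low_rank (n m : nat) (A : 'M[R]_(n, m)) : costed (svd_triple n m) :=
  let* F := svd A in
  let* _ := tick (3 * sr F) in
  ret (truncate (retained xi F) F).

(* X is select_last or select_first: the product X *m sU F extracts rows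
   (select_lastE, select_firstE), hence costs no arithmetic operation. *)
Definition partial_svd (b c p : nat) (X : 'M[R]_(p, b)) (F : svd_triple b c) :
    costed (svd_triple p c) :=
  let* W := mul (X *m sU F) (diag_mx (sS F)) in
  let* G := low_rank W in
  let* Vt := mul (sV G)^T (sV F)^T in
  ret (SVDTriple (sU G) (sS G) Vt^T).

Definition stitched_svd (c n : nat) (q : 'I_n -> nat)
    (F : forall i, svd_triple (q i) c) :
    costed (svd_triple (\sum_i q i) c) :=
  let* M := gather (fun i => mul (diag_mx (sS (F i))) (sV (F i))^T) in
  let* G := low_rank (\mxcol_i M i) in
  let* U := gather (fun i => mul (sU (F i)) (submxcol (sU G) i)) in
  ret (SVDTriple (\mxcol_i U i) (sS G) (sV G)).

(* Index of the block containing time tau; times start at 1, blocks at 0. *)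
Definition block_of (b tau : nat) : nat := (tau.-1 %/ b)%N.

Definition rows_before (b ts : nat) : nat := (ts.-1 - b * block_of b ts)%N.

Definition rows_after (b te : nat) : nat := (b * (block_of b te).+1 - te)%N.

Definition partial_S (b c : nat) (stored : nat -> svd_triple b c) (ts : nat) :
    costed (svd_triple (b - rows_before b ts) c) :=
  partial_svd (select_last b (rows_before b ts)) (stored (block_of b ts)).

Definition partial_E (b c : nat) (stored : nat -> svd_triple b c) (te : nat) :
    costed (svd_triple (b - rows_after b te) c) :=
  partial_svd (select_first b (rows_after b te)) (stored (block_of b te)).

(* SVD results with c columns and an arbitrary number of rows. *)
Definition any_rows (c : nat) : Type := {q : nat & svd_triple q c}.

(* Blocks S, S+1, ..., E-1, E. If S = E, the range S+1, ..., E-1 is empty and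
   both partial results (for S and for E) are stacked. *)
Definition stitched_blocks (b c : nat) (stored : nat -> svd_triple b c)
    (ts te : nat) (FS : svd_triple (b - rows_before b ts) c)
    (FE : svd_triple (b - rows_after b te) c) : seq (any_rows c) :=
  let S := block_of b ts in
  let E := block_of b te in
  Tagged (fun q => svd_triple q c) FS ::
  rcons [seq Tagged (fun q => svd_triple q c) (stored i)
           | i <- iota S.+1 (E - S.+1)]
        (Tagged (fun q => svd_triple q c) FE).

Definition query_phase (b c : nat) (stored : nat -> svd_triple b c)
    (ts te : nat) : costed (any_rows c) :=
  let* FS := partial_S stored ts in
  let* FE := partial_E stored te in
  let L := in_tuple (stitched_blocks stored FS FE) in
  let* F := stitched_svd (fun i => tagged (tnth L i)) in
  ret (Tagged (fun q => svd_triple q c) F).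

End Algorithm.

(* Row l of block i is row b * i + l of A, counting from 0. The default 0 is
   never used when b * i.+1 <= t. *)
Definition block (t c b : nat) (A : 'M[R]_(t, c)) (i : nat) : 'M[R]_(b, c) :=
  \matrix_(l, j) if insub (b * i + l)%N is Some r then A r j else 0.

End ZoomSVD.

(* Main.v *)
Require Import Defs.
From mathcomp Require Import all_boot all_order all_algebra.
From mathcomp Require Import reals.
From mathcomp Require Import zify ring.

Set Implicit Arguments.
Unset Strict Implicit.
Unset Printing Implicit Defensive.

Import Order.TTheory GRing.Theory Num.Theory.
Local Open Scope ring_scope.

(* Let N be the number of blocks strictly between the two boundary blocks, so
   that N b <= te - ts.  Scaling V^T by Sigma costs O(k^2 c) per boundary block,
   but O(k c^2) per inner block, whose number of singular values is at most both
   k and c.  The stacked matrix has at most (N + 2) k rows.  If N > 0, this is at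
   most 3 N k and its SVD costs O(N k c^2); if N = 0, the bound O(k c^2) would be
   too large, and one uses instead the other side of the minimum, O((2 k)^2 c). *)

(** The identity of size [r] factors through dimension [n], which bounds its rank. *)
Lemma orthonormal_cols_leq (F : fieldType) (n r : nat) (U : 'M[F]_(n, r)) :
  U^T *m U = 1%:M -> (r <= n)%N.
Proof.
by move=> UU; rewrite -[leqLHS](mxrank1 F) -UU (leq_trans (mxrankM_maxr _ _)) ?rank_leq_row.
Qed.

Lemma is_svd_leq_min (R : realType) (n m : nat) (A : 'M[R]_(n, m))
    (F : svd_triple R n m) :
  is_svd A F -> (sr F <= minn n m)%N.
Proof.
by case=> UU VV _ _ _; rewrite leq_min !(orthonormal_cols_leq UU, orthonormal_cols_leq VV).
Qed.

Lemma is_truncated_svd_leq_cols (R : realType) (n m : nat) (A : 'M[R]_(n, m))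
    (F : svd_triple R n m) :
  is_truncated_svd A F -> (sr F <= m)%N.
Proof.
move=> [G [j [/is_svd_leq_min Gr ->]]] /=.
exact: leq_trans (geq_minr _ _) (leq_trans Gr (geq_minr _ _)).
Qed.

(** Absorbs the linear cost of evaluating energy ratios into the quadratic terms. *)
Lemma leq_mul_sqr (b k : nat) : (0 < b)%N -> (k <= b * k ^ 2)%N.
Proof.
by move=> b0; case: k => // k; rewrite -mulnn mulnCA leq_pmulr // muln_gt0 b0.
Qed.

(** The 4 is the square of 2 in [r <= 2 * k] at [N = 0]; the 3 comes from [N + 2 <= 3 * N] for
    positive [N]. *)
Lemma leq_stacked_svd (N k c r : nat) :
  (r <= (N + 2) * k)%N ->
  (minn (r ^ 2 * c) (r * c ^ 2) <= 4 * (k ^ 2 * c) + 3 * (N * (k * c ^ 2)))%N.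
Proof.
case: N => [|N] rk.
  have := leq_mul (leq_mul rk rk) (leqnn c); rewrite geq_min; lia.
have /leq_mul/(_ (leqnn (c ^ 2))) : (r <= 3 * N.+1 * k)%N by nia.
rewrite geq_min; lia.
Qed.

(** The block of [ts] ends at or after [ts] and the block of [te] starts at or before [te]. If the
    two blocks coincide, truncated subtraction gives 0. *)
Lemma block_gap (b ts te : nat) :
  (0 < b)%N -> (1 <= ts)%N -> (ts <= te)%N ->
  ((block_of b te - (block_of b ts).+1) * b <= te - ts)%N.
Proof.
rewrite /block_of => b0 ts1 tste.
have := leq_trunc_div te.-1 b; have := ltn_ceil ts.-1 b0.
rewrite mulnBl; lia.
Qed.

Section Costs.

Variables (R : realType) (svd : svd_routine R) (mul : mul_routine R) (xi : R).
Variables Ks Km : nat.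
Hypothesis svd_correct : forall (n m : nat) (A : 'M[R]_(n, m)),
  is_svd A (value (svd A)).
Hypothesis svd_cost : forall (n m : nat) (A : 'M[R]_(n, m)),
  (cost (svd A) <= Ks * minn (n ^ 2 * m) (n * m ^ 2))%N.
Hypothesis mul_cost : forall (p q s : nat) (A : 'M[R]_(p, q)) (B : 'M[R]_(q, s)),
  (cost (mul A B) <= Km * (p * q * s))%N.

Lemma low_rank_leq_min (n m : nat) (A : 'M[R]_(n, m)) :
  (sr (value (low_rank svd xi A)) <= minn n m)%N.
Proof. exact: leq_trans (geq_minr _ _) (is_svd_leq_min (svd_correct A)). Qed.

Lemma cost_low_rank (n m : nat) (A : 'M[R]_(n, m)) :
  (cost (low_rank svd xi A) <=
     Ks * minn (n ^ 2 * m) (n * m ^ 2) + 3 * minn n m)%N.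
Proof.
by rewrite /= addn0 leq_add ?svd_cost // leq_mul2l (is_svd_leq_min (svd_correct A)).
Qed.

(** The matrix factored in Partial-SVD has only [sr F] columns, so its rank is at most [sr F]. *)
Lemma partial_svd_leq (b c p k : nat) (X : 'M[R]_(p, b)) (F : svd_triple R b c) :
  (sr F <= k)%N -> (sr (value (partial_svd svd mul xi X F)) <= k)%N.
Proof.
move=> Fk; apply: leq_trans (low_rank_leq_min _) _.
exact: leq_trans (geq_minr _ _) Fk.
Qed.

(** The factored matrix has at most [b] rows and [k] columns, so its scaling and its SVD cost O(b
    k^2). Multiplying the right factors costs O(k^2 c). *)
Lemma cost_partial_svd (b c p k : nat) (X : 'M[R]_(p, b)) (F : svd_triple R b c) :
  (0 < b)%N -> (p <= b)%N -> (sr F <= k)%N ->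
  (cost (partial_svd svd mul xi X F) <= (Km + Ks + 3) * (k ^ 2 * (b + c)))%N.
Proof.
move=> b0 pb Fk.
pose W := value (mul (X *m sU F) (diag_mx (sS F))).
pose G := value (low_rank svd xi W).
have Gk : (sr G <= k)%N := partial_svd_leq X Fk.
have c1 : (cost (mul (X *m sU F) (diag_mx (sS F))) <= Km * (b * k ^ 2))%N.
  by rewrite (leq_trans (mul_cost _ _)) // leq_mul2l -mulnA !leq_mul ?orbT.
have c2 : (cost (low_rank svd xi W) <= Ks * (b * k ^ 2) + 3 * k)%N.
  rewrite (leq_trans (cost_low_rank W)) // leq_add // leq_mul2l.
    by rewrite (leq_trans (geq_minr _ _)) ?orbT // leq_mul // leq_exp2r.
  by rewrite (leq_trans (geq_minr _ _)).
have c3 : (cost (mul (sV G)^T (sV F)^T) <= Km * (k ^ 2 * c))%N.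
  by rewrite (leq_trans (mul_cost _ _)) // leq_mul2l !leq_mul ?orbT.
have kk := leq_mul_sqr k b0.
have -> : cost (partial_svd svd mul xi X F) =
    (cost (mul (X *m sU F) (diag_mx (sS F))) +
     (cost (low_rank svd xi W) + cost (mul (sV G)^T (sV F)^T)))%N.
  by rewrite /= !addn0.
apply: leq_trans (leq_add c1 (leq_add c2 c3)) _.
rewrite mulnDr (mulnC (k ^ 2)%N b) mulnDr; nia.
Qed.

Lemma cost_stitched_svd (c n : nat) (q : 'I_n -> nat)
    (F : forall i, svd_triple R (q i) c) :
  (cost (stitched_svd svd mul xi F) <=
     Km * (\sum_i sr (F i) ^ 2 * c)
     + (Ks * minn ((\sum_i sr (F i)) ^ 2 * c) ((\sum_i sr (F i)) * c ^ 2)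
        + 3 * (\sum_i sr (F i)))
     + Km * (\sum_i q i * sr (F i) * sr (value (stitched_svd svd mul xi F))))%N.
Proof.
set s := sr _.
pose M := gather (fun i => mul (diag_mx (sS (F i))) (sV (F i))^T).
pose G := value (low_rank svd xi (\mxcol_i value M i)).
have -> : cost (stitched_svd svd mul xi F) =
    (cost M + cost (low_rank svd xi (\mxcol_i value M i)) +
     cost (gather (fun i => mul (sU (F i)) (submxcol (sU G) i))))%N.
  by rewrite /= !addn0 addnA.
apply: leq_add; last first.
  by rewrite big_distrr; apply: leq_sum => i _; exact: mul_cost.
apply: leq_add.
  by rewrite big_distrr; apply: leq_sum => i _; exact: mul_cost.
apply: leq_trans (cost_low_rank _) _.
(* The energy ratios are charged by the number of rows of the stack. *)
by rewrite leq_add2l leq_mul2l geq_minl.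
Qed.

Lemma cost_query_phase (b c k : nat) (stored : nat -> svd_triple R b c)
    (ts te : nat) :
  let N := (block_of b te - (block_of b ts).+1)%N in
  (0 < b)%N -> (ts <= te)%N ->
  (forall i, (block_of b ts <= i <= block_of b te)%N -> (sr (stored i) <= k)%N) ->
  (forall i, (i <= block_of b te)%N -> (sr (stored i) <= c)%N) ->
  (sr (tagged (value (query_phase svd mul xi stored ts te))) <= k)%N ->
  (cost (query_phase svd mul xi stored ts te) <=
     (5 * Km + 6 * Ks + 12) *
       (N * (b * k ^ 2) + N * (k * c ^ 2) + k ^ 2 * (b + c)))%N.
Proof.
move=> N b0 tste st_k st_c.
pose FS := value (partial_S svd mul xi stored ts).
pose FE := value (partial_E svd mul xi stored te).
pose L := stitched_blocks stored FS FE.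
pose F := fun i => tagged (tnth (in_tuple L) i).
rewrite [tagged _](_ : _ = value (stitched_svd svd mul xi F)) // => out_k.
have -> : cost (query_phase svd mul xi stored ts te) =
    (cost (partial_S svd mul xi stored ts) +
     (cost (partial_E svd mul xi stored te) + cost (stitched_svd svd mul xi F)))%N.
  by rewrite -[cost (stitched_svd _ _ _ _)]addn0.
have SE : (block_of b ts <= block_of b te)%N.
  by rewrite leq_div2r // -!subn1 leq_sub2r.
have FS_k : (sr FS <= k)%N by apply/partial_svd_leq/st_k; rewrite leqnn.
have FE_k : (sr FE <= k)%N by apply/partial_svd_leq/st_k; rewrite leqnn andbT.
have cS : (cost (partial_S svd mul xi stored ts) <= (Km + Ks + 3) * (k ^ 2 * (b + c)))%N.
  by apply: cost_partial_svd; rewrite ?leq_subr ?st_k ?leqnn.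
have cE : (cost (partial_E svd mul xi stored te) <= (Km + Ks + 3) * (k ^ 2 * (b + c)))%N.
  by apply: cost_partial_svd; rewrite ?leq_subr ?st_k ?leqnn ?andbT.
(* Common to the three sums below: two boundary entries bounded by [B], and [N] inner ones by
   [B']. *)
have sum_blocks (f : any_rows R c -> nat) (B B' : nat) :
    (f (Tagged _ FS) <= B)%N -> (f (Tagged _ FE) <= B)%N ->
    (forall i, (block_of b ts <= i <= block_of b te)%N ->
       (f (Tagged _ (stored i)) <= B')%N) ->
    (\sum_i f (tnth (in_tuple L) i) <= N * B' + 2 * B)%N.
  move=> fS fE fM; rewrite -(big_tnth _ _ L xpredT) /= big_cons -cats1 big_cat.
  rewrite big_map big_seq1 /=.
  suff : (\sum_(i <- iota (block_of b ts).+1 N) f (Tagged _ (stored i)) <= N * B')%N.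
    by rewrite -/N; lia.
  rewrite -[N in leqRHS](size_iota (block_of b ts).+1) -sum1_size big_distrl /=.
  rewrite big_seq [leqRHS]big_seq; apply: leq_sum => i.
  by rewrite mem_iota mul1n => iN; apply: fM; lia.
have c1 := @sum_blocks (fun x => sr (tagged x) ^ 2 * c)%N (k ^ 2 * c)%N (k * c ^ 2)%N.
have {}c1 : (\sum_i sr (F i) ^ 2 * c <= N * (k * c ^ 2) + 2 * (k ^ 2 * c))%N.
  apply: c1 => [||i iN] /=; rewrite ?leq_mul2r ?leq_exp2r ?FS_k ?FE_k ?orbT //.
  (* For an inner block, one factor [sr] is bounded by [k] and the other by [c]. *)
  by case/andP: (iN) => _ iE; rewrite -!mulnn -mulnA !leq_mul ?st_k ?st_c.
have c2 : (\sum_i sr (F i) <= (N + 2) * k)%N.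
  by rewrite mulnDl; apply: (@sum_blocks (fun x => sr (tagged x))).
set s := sr _ in out_k.
have c3 : (\sum_i tag (tnth (in_tuple L) i) * sr (F i) * s <=
    N * (b * k ^ 2) + 2 * (b * k ^ 2))%N.
  apply: (@sum_blocks (fun x => tag x * sr (tagged x) * s)%N) => [||i iN] /=;
  by rewrite -mulnn mulnA !leq_mul ?leq_subr ?st_k.
have := leq_stacked_svd c c2; have := cost_stitched_svd F.
rewrite -/s; move: (minn _ _) (cost _) c1 c2 c3 => m Q c1 c2 c3 QH mH.
have kk := leq_mul_sqr k b0.
have c4 : (\sum_i sr (F i) <= N * (b * k ^ 2) + 2 * (b * k ^ 2))%N.
  by apply: leq_trans c2 _; rewrite -mulnDl leq_mul.
have c5 := leq_mul (leqnn Km) c1; have c6 := leq_mul (leqnn Km) c3.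
have c7 := leq_mul (leqnn Ks) mH.
(* The [k ^ 2 * c] terms need 2 + 4 times [Ks], from the two Partial-SVDs and the stacked SVD. The
   12 is 2 * 3 for the energy ratios of the Partial-SVDs plus 3 * 2 for those of the stack. *)
nia.
Qed.

End Costs.

Theorem theorem2 (R : realType) (svd : svd_routine R) (mul : mul_routine R)
  (svd_correct : forall (n m : nat) (A : 'M[R]_(n, m)),
     is_svd A (value (svd n m A)))
  (mul_correct : forall (p q s : nat) (A : 'M[R]_(p, q)) (B : 'M[R]_(q, s)),
     value (mul p q s A B) = A *m B)
  (svd_cost : exists K : nat, forall (n m : nat) (A : 'M[R]_(n, m)),
     (cost (svd n m A) <= K * minn (n ^ 2 * m) (n * m ^ 2))%N)
  (mul_cost : exists K : nat,
     forall (p q s : nat) (A : 'M[R]_(p, q)) (B : 'M[R]_(q, s)),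
     (cost (mul p q s A B) <= K * (p * q * s))%N) :
  exists C : R, 0 < C /\
    forall (t c b : nat) (A : 'M[R]_(t, c)) (stored : nat -> svd_triple R b c)
      (xi : R) (ts te k : nat),
    (0 < b)%N ->
    0 < xi < 1 ->
    (1 <= ts)%N -> (ts <= te)%N -> (te <= t)%N ->
    (* the block containing te is complete *)
    (b * (block_of b te).+1 <= t)%N ->
    (forall i : nat, (b * i.+1 <= t)%N ->
       is_truncated_svd (block b A i) (stored i)) ->
    (* at most k singular values are retained in each SVD result *)
    (forall i : nat, (block_of b ts <= i <= block_of b te)%N ->
       (sr (stored i) <= k)%N) ->
    (sr (value (partial_S svd mul xi stored ts)) <= k)%N ->
    (sr (value (partial_E svd mul xi stored te)) <= k)%N ->
    (sr (tagged (value (query_phase svd mul xi stored ts te))) <= k)%N ->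
    (cost (query_phase svd mul xi stored ts te))%:R <=
      C * ((te%:R - ts%:R) * k%:R * (k%:R + c%:R ^+ 2 / b%:R)
           + k%:R ^+ 2 * (b%:R + c%:R)).
Proof.
case: svd_cost => Ks {}svd_cost; case: mul_cost => Km {}mul_cost.
exists (5 * Km + 6 * Ks + 12)%:R; split; first by rewrite ltr0n addnS.
move=> t c b A stored xi ts te k b0 _ ts1 tste _ te_t st_svd st_k _ _ out_k.
(* All blocks up to that of [te] are complete because that one is. *)
have st_c i : (i <= block_of b te)%N -> (sr (stored i) <= c)%N.
  move=> iE; apply: (is_truncated_svd_leq_cols (st_svd i _)).
  by apply: leq_trans te_t; rewrite leq_mul2l ltnS iE orbT.
have := cost_query_phase svd_correct svd_cost mul_cost b0 tste st_k st_c out_k.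
rewrite -(ler_nat R) => /le_trans; apply; rewrite natrM ler_wpM2l ?ler0n //.
have := block_gap b0 ts1 tste; move: (block_of b te - _)%N => N.
rewrite -(ler_nat R) natrM natrB // => gap.
rewrite !natrD !(natrX, natrM) natrD lerD2r.
have b0R : 0 < b%:R :> R by rewrite ltr0n.
(* Factoring out [N * b], which [gap] bounds by [te - ts], produces the quotient [c ^ 2 / b]. *)
have -> : N%:R * (b%:R * k%:R ^+ 2) + N%:R * (k%:R * c%:R ^+ 2) =
    N%:R * b%:R * k%:R * (k%:R + c%:R ^+ 2 / b%:R) :> R.
  by field; rewrite gt_eqF.
rewrite ler_wpM2r ?ler_wpM2r //.
by rewrite addr_ge0 // divr_ge0 // exprn_ge0.
Qed.
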